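(* Let $\mathcal{H}$ be a complex Hilbert space, let $A\in\mathcal{B}(\mathcal{H})$ be positive semidefinite, let $\mathbb{A}=\begin{pmatrix}A&O\\O&A\end{pmatrix}$ on $\mathcal{H}\oplus\mathcal{H}$, let $X\in\mathcal{B}_{A^{1/2}}(\mathcal{H})$, and let $\mathbb{S}=\begin{pmatrix}O&X\\O&O\end{pmatrix}$. Then $$dw_{\mathbb{A}}(\mathbb{S})=\begin{cases}0, & \|X\|_A=0,\\[2pt] \dfrac{\|X\|_A}{2\sqrt{1-\|X\|_A^2}}, & \|X\|_A<\frac1{\sqrt2},\\[6pt] \|X\|_A^2, & \|X\|_A\ge\frac1{\sqrt2}.\end{cases}$$
   Context: $\mathcal{B}(\mathcal{H})$ is the algebra of bounded linear operators on the complex Hilbert space $\mathcal{H}$; $O$ is the zero operator. For a positive semidefinite $A\in\mathcal{B}(\mathcal{H})$, put $\langle x,y\rangle_A=\langle Ax,y\rangle$ and $\|x\|_A=\sqrt{\langle x,x\rangle_A}$. $\mathcal{B}_{A^{1/2}}(\mathcal{H})$ is the set of $T\in\mathcal{B}(\mathcal{H})$ that are $A$-bounded: there is $c>0$ with $\|Tx\|_A\le c\|x\|_A$ for all $x\in\mathcal{H}$. For such $T$: $\|T\|_A=\sup\{\|Tx\|_A:x\in\mathcal{H},\|x\|_A=1\}$ and $dw_A(T)=\sup\{\sqrt{|\langle Tx,x\rangle_A|^2+\|Tx\|_A^4}:x\in\mathcal{H},\|x\|_A=1\}$. $dw_{\mathbb{A}}$ is defined in the same way for $\mathbb{A}$-bounded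 operators on the Hilbert space $\mathcal{H}\oplus\mathcal{H}$ with the positive operator $\mathbb{A}$ in place of $A$. *)

(* Defs.v *)
From HB Require Import structures.
From mathcomp Require Import all_boot all_order all_algebra.
From mathcomp Require Import complex.
From mathcomp Require Import all_classical all_reals all_analysis.

Set Implicit Arguments.
Unset Strict Implicit.
Unset Printing Implicit Defensive.

Import Order.TTheory GRing.Theory Num.Def Num.Theory.
Import numFieldNormedType.Exports.

Local Open Scope classical_set_scope.
Local Open Scope ring_scope.
Local Open Scope complex_scope.

(* The form is linear in its first argument and conjugate-linear in its
   second one. *)
HB.mixin Record NormedModule_isInner (R : realType) H
    of NormedModule R[i] H := {
  inner : {dot H for (@conjC R[i])} ;
  normr_inner : forall x : H, `|x| = sqrtC (inner x x)
}.

#[short(type="hilbertType")]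
HB.structure Definition Hilbert (R : realType) :=
  {H of NormedModule_isInner R H & CompleteNormedModule R[i] H}.

Section dot_norm.
Variables (C : numClosedFieldType) (U : lmodType C) (f : {dot U for (@conjC C)}).

Lemma dot_CauchySchwarz u v : `|f u v| ^+ 2 <= f u u * f v v.
Proof.
have [->|v0] := eqVneq v 0; first by rewrite linear0r normr0 expr0n mulr_ge0 ?dnorm_ge0.
have fv0 : 0 < f v v by rewrite dnorm_gt0.
pose a := f u v / f v v.
have ou : f (u - a *: v) v = 0.
  by rewrite linearBl/= linearZl_LR/= divfK ?subrr// gt_eqF.
rewrite -[X in f X X](subrK (a *: v)) (hnormDd (u := u - a *: v)); last first.
  by rewrite linearZr_LR/= ou mulr0.
rewrite /= dnormZ mulrDl -mulrA -expr2 -[X in X <= _]add0r lerD//.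
  by rewrite mulr_ge0// dnorm_ge0.
by rewrite /a normf_div expr_div_n (gtr0_norm fv0) divfK// expf_neq0// gt_eqF.
Qed.

Lemma dot_triangle u v : sqrtC (f (u + v) (u + v)) <= sqrtC (f u u) + sqrtC (f v v).
Proof.
rewrite -ler_sqr ?nnegrE ?addr_ge0 ?sqrtC_ge0 ?dnorm_ge0//.
rewrite sqrrD !sqrtCK addrAC dnormD lerD2l.
have -> : f u v + (f u v)^* = 'Re (f u v) *+ 2.
  by rewrite ReE -mulr_natr divfK// pnatr_eq0.
rewrite lerMn2r/=; apply: le_trans (leif_Re_Creal _) _.
rewrite -ler_sqr ?nnegrE ?mulr_ge0 ?sqrtC_ge0 ?dnorm_ge0//.
by rewrite exprMn !sqrtCK dot_CauchySchwarz.
Qed.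
End dot_norm.

Section hilbert_sum.
Variables (R : realType) (H K : hilbertType R).

(* The canonical norm of [H * K] is the maximum norm, hence the alias. *)
Definition hsum : Type := (H * K)%type.

HB.instance Definition _ := GRing.Lmodule.copy hsum (H * K)%type.

Definition hsum_inner (u v : hsum) : R[i] := inner u.1 v.1 + inner u.2 v.2.

Let hsum_inner_bilinear : bilinear_for ( *%R) (@conjC R[i] \; *%R) hsum_inner.
Proof.
split=> w a u v; rewrite /hsum_inner/=.
  by rewrite !linearPl/= mulrDr addrACA.
by rewrite !linearPr/= mulrDr addrACA.
Qed.

HB.instance Definition _ :=
  bilinear_isBilinear.Build R[i] hsum hsum _ _ _ hsum_inner hsum_inner_bilinear.

Let hsum_inner_herm (u v : hsum) :
  hsum_inner u v = (-1) ^+ false * (hsum_inner v u)^*.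
Proof.
by rewrite /hsum_inner expr0 mul1r rmorphD/= hermC/= [X in _ + X]hermC/= !mul1r.
Qed.

HB.instance Definition _ := isHermitianSesquilinear.Build R[i] hsum
  false (@conjC R[i]) hsum_inner hsum_inner_herm.

Let hsum_inner_gt0 (u : hsum) : u != 0 -> 0 < hsum_inner u u.
Proof.
case: u => x y; rewrite -pair_eqE/= negb_and => /orP[x0|y0]; rewrite /hsum_inner/=.
  by rewrite ltr_wpDr// ?dnorm_ge0// dnorm_gt0.
by rewrite ltr_wpDl// ?dnorm_ge0// dnorm_gt0.
Qed.

HB.instance Definition _ := isDotProduct.Build R[i] hsum hsum_inner hsum_inner_gt0.

Definition hsum_dot : {dot hsum for (@conjC R[i])} := hsum_inner.

Definition hsum_norm (u : hsum) : R[i] := sqrtC (hsum_inner u u).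

Let hsum_normD u v : hsum_norm (u + v) <= hsum_norm u + hsum_norm v.
Proof. exact: (dot_triangle hsum_dot). Qed.

Let hsum_normZ a u : hsum_norm (a *: u) = `|a| * hsum_norm u.
Proof.
rewrite /hsum_norm (dnormZ hsum_dot)/= sqrtCM ?nnegrE ?exprn_ge0//.
  by rewrite sqrCK.
exact: (dnorm_ge0 hsum_dot).
Qed.

Let hsum_norm0_eq0 u : hsum_norm u = 0 -> u = 0.
Proof. by move/eqP; rewrite sqrtC_eq0 (dnorm_eq0 hsum_dot) => /eqP. Qed.

HB.instance Definition _ := Lmodule_isNormed.Build R[i] hsum
  hsum_normD hsum_normZ hsum_norm0_eq0.

Let hsum_normE (u : hsum) : `|u| = sqrtC (`|u.1| ^+ 2 + `|u.2| ^+ 2).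
Proof. by rewrite !normr_inner !sqrtCK. Qed.

Let ler_fst (u : hsum) : `|u.1| <= `|u|.
Proof.
rewrite hsum_normE -ler_sqr ?nnegrE ?sqrtC_ge0 ?addr_ge0 ?exprn_ge0//.
by rewrite sqrtCK lerDl exprn_ge0.
Qed.

Let ler_snd (u : hsum) : `|u.2| <= `|u|.
Proof.
rewrite hsum_normE -ler_sqr ?nnegrE ?sqrtC_ge0 ?addr_ge0 ?exprn_ge0//.
by rewrite sqrtCK lerDr exprn_ge0.
Qed.

Let ler_hsum_norm (u : hsum) : `|u| <= `|u.1| + `|u.2|.
Proof.
rewrite hsum_normE -ler_sqr ?nnegrE ?addr_ge0 ?sqrtC_ge0 ?addr_ge0 ?exprn_ge0//.
by rewrite sqrtCK sqrrD -addrA lerD2l lerDr mulrn_wge0// mulr_ge0.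
Qed.

Let cauchy_proj (V : completeNormedModType R[i]) (p : hsum -> V)
    (F : set_system hsum) :
  (forall u v, `|p u - p v| <= `|u - v|) ->
  ProperFilter F -> cauchy F -> cauchy (p @ F).
Proof.
move=> pB FF /cauchy_ballP Fc; apply/cauchy_ballP => e e0.
rewrite near_map2.
have := Fc _ e0; apply: filterS => -[u v].
by rewrite -!ball_normE/=; apply: le_lt_trans; exact: pB.
Qed.

Let hsum_complete (F : set_system hsum) :
  ProperFilter F -> cauchy F -> cvg F.
Proof.
move=> FF Fc.
have /cauchy_cvg/cvg_ex[a Fa] : cauchy ((fst : hsum -> H) @ F).
  by apply: cauchy_proj Fc => u v; exact: (ler_fst (u - v)).
have /cauchy_cvg/cvg_ex[b Fb] : cauchy ((snd : hsum -> K) @ F).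
  by apply: cauchy_proj Fc => u v; exact: (ler_snd (u - v)).
apply/cvg_ex; exists ((a, b) : hsum); apply/cvgrPdist_lt => e e0.
have e20 : 0 < e / 2 by rewrite divr_gt0.
move/cvgrPdist_lt : Fa => /(_ _ e20) Fa.
move/cvgrPdist_lt : Fb => /(_ _ e20) Fb.
near=> u; apply: le_lt_trans (ler_hsum_norm _) _.
rewrite (splitr e) ltrD//.
  by near: u; exact: Fa.
by near: u; exact: Fb.
Unshelve. all: by end_near. Qed.

HB.instance Definition _ := Uniform_isComplete.Build hsum hsum_complete.

HB.instance Definition _ := NormedModule_isInner.Build R hsum
  (fun u => erefl : `|u| = sqrtC (hsum_dot u u)).

End hilbert_sum.

Section block_operator.
Variables (R : realType) (H K : hilbertType R).
Variables (T11 : {linear H -> H}) (T12 : {linear K -> H})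
          (T21 : {linear H -> K}) (T22 : {linear K -> K}).

Definition block_op (u : hsum H K) : hsum H K :=
  (T11 u.1 + T12 u.2, T21 u.1 + T22 u.2).

Let block_op_linear : linear block_op.
Proof.
move=> a u v; rewrite /block_op/= !linearP.
by congr pair => /=; rewrite scalerDr addrACA.
Qed.

HB.instance Definition _ :=
  GRing.isLinear.Build R[i] (hsum H K) (hsum H K) _ block_op block_op_linear.

End block_operator.

Section operators.
Variables (R : realType) (H : hilbertType R).
Implicit Types (A T : {linear H -> H}) (x y : H).

Definition bounded_op T := exists c : R, forall x, `|T x| <= c%:C * `|x|.

Definition positive_op A := forall x, 0 <= inner (A x) x.

Definition innerA A x y : R[i] := inner (A x) y.

(* [<x, x>_A] is a nonnegative real number when [A] is positive. *)
Definition normA A x : R := Num.sqrt (complex.Re (innerA A x x)).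

Definition A_bounded A T :=
  exists2 c : R, 0 < c & forall x, normA A (T x) <= c * normA A x.

(* [sup] is the real-valued supremum, with [sup set0 = 0]: this is the value of
   the next two quantities when no [x] satisfies [normA A x = 1]. *)
Definition op_normA A T : R :=
  sup [set normA A (T x) | x in [set x | normA A x = 1]].

Definition dwA A T : R :=
  sup [set Num.sqrt (Normc.normc (innerA A (T x) x) ^+ 2 + normA A (T x) ^+ 4)
      | x in [set x | normA A x = 1]].

End operators.

Section block_operator_theory.
Variables (R : realType) (H : hilbertType R).
Implicit Types (A X : {linear H -> H}).

Let Z : {linear H -> H} := \0.

Lemma block_op_bounded (T11 T12 T21 T22 : {linear H -> H}) :
  bounded_op T11 -> bounded_op T12 -> bounded_op T21 -> bounded_op T22 ->
  bounded_op (block_op T11 T12 T21 T22).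
Proof.
have fst_le (u : hsum H H) : `|u.1| <= `|u|.
  rewrite !normr_inner ler_sqrtC ?nnegrE ?dnorm_ge0// lerDl; exact: dnorm_ge0.
have snd_le (u : hsum H H) : `|u.2| <= `|u|.
  rewrite !normr_inner ler_sqrtC ?nnegrE ?dnorm_ge0// lerDr; exact: dnorm_ge0.
have bound (T : {linear H -> H}) (c : R) (x : H) (u : hsum H H) :
    (forall y, `|T y| <= c%:C * `|y|) -> `|x| <= `|u| ->
    `|T x| <= `|c|%:C * `|u|.
  move=> Tc xu; apply: le_trans (Tc x) _.
  apply: (@le_trans _ _ (`|c|%:C * `|x|)).
    by rewrite ler_wpM2r// lecR ler_norm.
  by rewrite ler_wpM2l// ler0c.
have pair_le (x y : H) : `|((x, y) : hsum H H)| <= `|x| + `|y|.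
  have -> : `|((x, y) : hsum H H)| = sqrtC (`|x| ^+ 2 + `|y| ^+ 2).
    by rewrite !normr_inner !sqrtCK.
  rewrite -ler_sqr ?nnegrE ?addr_ge0 ?sqrtC_ge0 ?addr_ge0 ?exprn_ge0//.
  by rewrite sqrtCK sqrrD -addrA lerD2l lerDr mulrn_wge0// mulr_ge0.
move=> [c11 h11] [c12 h12] [c21 h21] [c22 h22].
exists (`|c11| + `|c12| + (`|c21| + `|c22|)) => u.
apply: le_trans (pair_le _ _) _; rewrite !rmorphD/= !mulrDl.
by apply: lerD; (apply: le_trans (ler_normD _ _) _; apply: lerD); apply: bound.
Qed.

Lemma block_diag_positive A : positive_op A -> positive_op (block_op A Z Z A).
Proof.
move=> A0 u; change (0 <= inner (A u.1 + 0) u.1 + inner (0 + A u.2) u.2).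
by rewrite addr0 add0r addr_ge0// A0.
Qed.

Lemma block_offdiag_A_bounded A X : positive_op A -> A_bounded A X ->
  A_bounded (block_op A Z Z A) (block_op Z X Z Z).
Proof.
have nE (u : hsum H H) : normA (block_op A Z Z A) u =
    Num.sqrt (complex.Re (inner (A u.1) u.1) + complex.Re (inner (A u.2) u.2)).
  change (Num.sqrt (complex.Re (inner (A u.1 + 0) u.1 + inner (0 + A u.2) u.2)) =
    Num.sqrt (complex.Re (inner (A u.1) u.1) + complex.Re (inner (A u.2) u.2))).
  by rewrite addr0 add0r; congr Num.sqrt; exact: (raddfD (@complex.Re R : Rcomplex R -> R)).
move=> A0 [c c0 Xc]; exists c => // u.
have Re_ge0 x : 0 <= complex.Re (inner (A x) x).
  by have := A0 x; rewrite lecE => /andP[].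
have -> : normA (block_op A Z Z A) (block_op Z X Z Z u) = normA A (X u.2).
  rewrite nE/= add0r addr0 linear0 /normA /innerA; congr Num.sqrt.
  exact: addr0.
apply: le_trans (Xc _) _; rewrite ler_pM2l// nE ler_sqrt ?addr_ge0//.
by rewrite /innerA lerDr.
Qed.

End block_operator_theory.

(* Main.v *)
Require Import Defs.
From mathcomp Require Import all_boot all_order all_algebra.
From mathcomp Require Import complex.
From mathcomp Require Import all_classical all_reals all_analysis.
From mathcomp Require Import ring lra.

(* For a unit vector (x1, x2) with |x2|_A^2 = t, the value at (x1, x2) is the
   square root of |<X x2, x1>_A|^2 + |X x2|_A^4.  By Cauchy-Schwarz its square is
   at most N^2 t (1 - t) + N^4 t^2, where N = |X|_A.  Taking x1 parallel to X x2
   shows that this is sharp, with N replaced by |X x|_A for any unit vector x and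
   any t in [0, 1].  It remains to maximise N^2 (t - (1 - N^2) t^2) over [0, 1]:
   the maximum is at t = 1 / (2 (1 - N^2)) if N^2 <= 1 / 2 and at t = 1
   otherwise. *)

Set Implicit Arguments.
Unset Strict Implicit.
Unset Printing Implicit Defensive.

Import Order.TTheory GRing.Theory Num.Theory.
Import numFieldNormedType.Exports.

Local Open Scope ring_scope.

(** * The semi-inner product of a positive operator *)

Section semi_inner_product.
Local Open Scope complex_scope.
Variables (R : realType) (H : hilbertType R) (A : {linear H -> H}).
Implicit Types x y : H.

Lemma innerADl x y z : innerA A (x + y) z = innerA A x z + innerA A y z.
Proof. by rewrite /innerA linearD linearDl. Qed.

Lemma innerADr x y z : innerA A x (y + z) = innerA A x y + innerA A x z.
Proof. by rewrite /innerA linearDr. Qed.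

Lemma innerAZl a x y : innerA A (a *: x) y = a * innerA A x y.
Proof. by rewrite /innerA linearZ linearZl_LR. Qed.

Lemma innerAZr a x y : innerA A x (a *: y) = conjc a * innerA A x y.
Proof. by rewrite /innerA linearZr_LR. Qed.

Lemma innerA0l y : innerA A 0 y = 0.
Proof. by rewrite -(scale0r 0) innerAZl mul0r. Qed.

Hypothesis A_pos : positive_op A.

Lemma innerA_self x : innerA A x x = (complex.Re (innerA A x x))%:C.
Proof.
have := A_pos x; rewrite lecE => /andP[/eqP im0 _].
by rewrite /innerA; move: im0; case: (inner (A x) x) => a b /= ->.
Qed.

Lemma Re_innerA_ge0 x : 0 <= complex.Re (innerA A x x).
Proof. by have := A_pos x; rewrite lecE => /andP[]. Qed.

Lemma sqr_normA x : normA A x ^+ 2 = complex.Re (innerA A x x).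
Proof. by rewrite sqr_sqrtr// Re_innerA_ge0. Qed.

Lemma normA_ge0 x : 0 <= normA A x.
Proof. exact: sqrtr_ge0. Qed.

Lemma innerA_selfE x : innerA A x x = (normA A x ^+ 2)%:C.
Proof. by rewrite sqr_normA -innerA_self. Qed.

(* Polarisation: [<z, z>_A] is real at [z = x + y] and at [z = x + i y]. *)
Lemma innerAC x y : innerA A y x = conjc (innerA A x y).
Proof.
have := innerA_selfE (x + y); have := innerA_selfE (x + 'i *: y).
rewrite !(innerADl, innerADr, innerAZl, innerAZr) !innerA_selfE.
case: (innerA A x y) => a b; case: (innerA A y x) => c d /=.
move: (_ ^+ 2) => p; move: (_ ^+ 2) => q.
move: (_ ^+ 2) => r; move: (_ ^+ 2) => s.
by move=> [_ h1] [_ h2]; congr (_ +i* _); lra.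
Qed.

Lemma normAZ (r : R) x : normA A (r%:C *: x) = `|r| * normA A x.
Proof.
rewrite {1}/normA innerAZl innerAZr innerA_selfE conjc_real -!rmorphM/=.
by rewrite mulrA -expr2 -exprMn sqrtr_sqr normrM (ger0_norm (normA_ge0 x)).
Qed.

(** Since [A] is only semidefinite, [normA A y] may vanish, so dividing by it is avoided:
    [z = s x - t c y] with [c = innerA A x y] and two free real parameters [s], [t] gives a
    nonnegative quadratic form. *)
Lemma innerA_CauchySchwarz x y :
  Normc.normc (innerA A x y) <= normA A x * normA A y.
Proof.
pose c := innerA A x y; pose n := Normc.normc c ^+ 2.
have nE : n = complex.Re c ^+ 2 + complex.Im c ^+ 2.
  by rewrite /n; case: (c) => a b /=; rewrite sqr_sqrtr// addr_ge0 ?sqr_ge0.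
have quadratic_ge0 (s t : R) :
    0 <= s ^+ 2 * normA A x ^+ 2 - s * t * n *+ 2 + t ^+ 2 * n * normA A y ^+ 2.
  have := Re_innerA_ge0 (s%:C *: x - (t%:C * c) *: y).
  rewrite -scaleNr !(innerADl, innerADr, innerAZl, innerAZr) !innerA_selfE.
  rewrite (innerAC x y) -/c nE; case: (c) => a b /=.
  move: (_ ^+ 2) => p; move: (normA A y ^+ 2) => q.
  lra.
have n_le : n <= normA A x ^+ 2 * normA A y ^+ 2.
  have [y0|y0] := eqVneq (normA A y) 0.
    have [n0|n0] := eqVneq n 0; first by rewrite n0 mulr_ge0 ?sqr_ge0.
    (* If [y] is null but [n] is not, the form is affine in [t]; this [t] makes it equal to
       [- normA A x ^+ 2 - 2], a contradiction. *)
    have := quadratic_ge0 1 ((normA A x ^+ 2 + 1) / n).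
    rewrite y0 expr0n !mulr0/= expr1n !mul1r divfK//.
    by have := sqr_ge0 (normA A x); lra.
  have y2 : 0 < normA A y ^+ 2 by rewrite exprn_even_gt0//= y0.
  rewrite -(ler_pM2l y2); have := quadratic_ge0 (normA A y ^+ 2) 1.
  by move: (normA A x ^+ 2) (normA A y ^+ 2) => p q; lra.
rewrite -ler_sqr ?nnegrE ?mulr_ge0 ?normA_ge0 ?exprMn//.
by rewrite /Normc.normc; case: innerA => ? ?; exact: sqrtr_ge0.
Qed.

End semi_inner_product.

(** * Bounds on real suprema with default value 0 *)

Section real_sup.
Local Open Scope classical_set_scope.
Variables (R : realType) (E : set R).

Lemma sup_ge0 : (forall x, E x -> 0 <= x) -> 0 <= sup E.
Proof.
move=> E0; have [hE|/sup_out ->//] := pselect (has_sup E).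
by have [[x Ex] _] := hE; apply: le_trans (E0 x Ex) _; exact: sup_upper_bound.
Qed.

(** Asking for [0 <= c] instead of a nonempty [E] covers the case where no unit vector exists, in
    which [sup] is 0. *)
Lemma sup_le_nonneg (c : R) : 0 <= c -> (forall x, E x -> x <= c) -> sup E <= c.
Proof.
move=> c0 Ec; have [hE|/sup_out ->//] := pselect (has_sup E).
by apply: ge_sup; [case: hE | exact: Ec].
Qed.

End real_sup.

(** * The operator seminorm *)

Section operator_seminorm.
Variables (R : realType) (H : hilbertType R) (A X : {linear H -> H}).
Hypotheses (A_pos : positive_op A) (X_A_bnd : A_bounded A X).

Lemma normA_le_op_normA x : normA A x = 1 -> normA A (X x) <= op_normA A X.
Proof.
move=> x1; have [c _ Xc] := X_A_bnd; apply: ub_le_sup; last by exists x.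
by exists c => _ [y /= y1 <-]; rewrite (le_trans (Xc y))// y1 mulr1.
Qed.

Lemma op_normA_ge0 : 0 <= op_normA A X.
Proof. by apply: sup_ge0 => _ [x _ <-]; exact: normA_ge0. Qed.

Lemma op_normA_le (c : R) : 0 <= c ->
  (forall x, normA A x = 1 -> normA A (X x) <= c) -> op_normA A X <= c.
Proof. by move=> c0 Xc; apply: sup_le_nonneg => // _ [x x1 <-]; exact: Xc. Qed.

(** The supremum only sees unit vectors. Other non-null vectors are rescaled, while on null vectors
    [A]-boundedness forces [X x] to be null as well. *)
Lemma normA_op_le x : normA A (X x) <= op_normA A X * normA A x.
Proof.
have [x0|x0] := eqVneq (normA A x) 0.
  by rewrite x0 mulr0; have [c _ /(_ x)] := X_A_bnd; rewrite x0 mulr0.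
have x_gt0 : 0 < normA A x by rewrite lt_def x0 normA_ge0.
pose r := (normA A x)^-1; have r0 : 0 < r by rewrite invr_gt0.
have := @normA_le_op_normA (r%:C%C *: x).
rewrite linearZ/= !normAZ// (gtr0_norm r0) mulVf// => /(_ erefl).
by rewrite ler_pdivrMl// mulrC.
Qed.

End operator_seminorm.

(** * Two-sided estimates for the off-diagonal block operator *)

Section shift.
Variables (R : realType) (H : hilbertType R) (A X : {linear H -> H}).
Hypotheses (A_pos : positive_op A) (X_A_bnd : A_bounded A X).

Let O : {linear H -> H} := \0.
Let AA := block_op A O O A.
Let SS := block_op O X O O.
Let N := op_normA A X.

Lemma innerA_block_diag (u v : hsum H H) :
  innerA AA u v = innerA A u.1 v.1 + innerA A u.2 v.2.
Proof.
change (inner (A u.1 + 0) v.1 + inner (0 + A u.2) v.2 =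
  innerA A u.1 v.1 + innerA A u.2 v.2).
by rewrite addr0 add0r.
Qed.

Lemma innerA_shift (u : hsum H H) : innerA AA (SS u) u = innerA A (X u.2) u.1.
Proof. by rewrite innerA_block_diag/= add0r !addr0 innerA0l addr0. Qed.

Lemma sqr_normA_block_diag (u : hsum H H) :
  normA AA u ^+ 2 = normA A u.1 ^+ 2 + normA A u.2 ^+ 2.
Proof.
rewrite (sqr_normA (block_diag_positive A_pos)) innerA_block_diag.
by rewrite !innerA_selfE// -rmorphD.
Qed.

Lemma normA_shift (u : hsum H H) : normA AA (SS u) = normA A (X u.2).
Proof.
rewrite {1}/normA innerA_block_diag /= add0r !addr0 innerA0l.
by rewrite addr0.
Qed.

Let dw_shift (u : hsum H H) :=
  Num.sqrt (Normc.normc (innerA AA (SS u) u) ^+ 2 + normA AA (SS u) ^+ 4).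

(* [t] is the squared seminorm of the second component of a unit vector. *)
Lemma dw_shift_le (D : R) (u : hsum H H) : 0 <= D ->
    (forall t, 0 <= t <= 1 -> N ^+ 2 * t * (1 - t) + N ^+ 4 * t ^+ 2 <= D ^+ 2) ->
  normA AA u = 1 -> dw_shift u <= D.
Proof.
move=> D0 ND u1; rewrite -[D](ger0_norm D0) -sqrtr_sqr ler_wsqrtr//.
have := congr1 (fun r => r ^+ 2) u1.
rewrite /= expr1n sqr_normA_block_diag innerA_shift normA_shift => u12.
have c0 : 0 <= Normc.normc (innerA A (X u.2) u.1).
  by case: innerA => ? ?; exact: sqrtr_ge0.
have cv : Normc.normc (innerA A (X u.2) u.1) ^+ 2 <=
    normA A (X u.2) ^+ 2 * normA A u.1 ^+ 2.
  rewrite -exprMn ler_sqr ?nnegrE ?mulr_ge0 ?normA_ge0//.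
  exact: innerA_CauchySchwarz.
have vM : normA A (X u.2) ^+ 2 <= N ^+ 2 * normA A u.2 ^+ 2.
  rewrite -exprMn ler_sqr ?nnegrE ?mulr_ge0 ?normA_ge0 ?op_normA_ge0//.
  exact: normA_op_le.
move: cv vM.
have := ND (normA A u.2 ^+ 2).
have -> : normA A (X u.2) ^+ 4 = (normA A (X u.2) ^+ 2) ^+ 2 by rewrite -exprM.
have -> : N ^+ 4 = (N ^+ 2) ^+ 2 by rewrite -exprM.
have := sqr_ge0 (normA A u.1); have := sqr_ge0 (normA A u.2).
have := sqr_ge0 (normA A (X u.2)).
move: u12; move: (normA A u.1 ^+ 2) (normA A u.2 ^+ 2) => p q.
move: (normA A (X u.2) ^+ 2) (N ^+ 2) => v M pq v0 q0 p0 hD cv vM.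
have pE : p = 1 - q by rewrite -pq addrK.
have {}hD : M * q * (1 - q) + M ^+ 2 * q ^+ 2 <= D ^+ 2 by apply: hD; lra.
rewrite pE in p0 cv.
(* Both terms of [v * (1 - q) + v ^+ 2] increase with [v >= 0], so [v] may be replaced by its bound
   [M * q]. *)
have : v * (1 - q) <= M * q * (1 - q) by rewrite ler_wpM2r.
have : v ^+ 2 <= (M * q) ^+ 2 by rewrite ler_sqr ?nnegrE// (le_trans v0).
by rewrite exprMn; lra.
Qed.

Lemma dwA_shift_le (D : R) : 0 <= D ->
    (forall t, 0 <= t <= 1 -> N ^+ 2 * t * (1 - t) + N ^+ 4 * t ^+ 2 <= D ^+ 2) ->
  dwA AA SS <= D.
Proof. by move=> D0 ND; apply: sup_le_nonneg => // _ [u /= u1 <-]; exact: dw_shift_le. Qed.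

Lemma dwA_shift_ge0 : 0 <= dwA AA SS.
Proof. by apply: sup_ge0 => _ [u _ <-]; exact: sqrtr_ge0. Qed.

Lemma dw_shift_le_dwA (u : hsum H H) : normA AA u = 1 -> dw_shift u <= dwA AA SS.
Proof.
move=> u1; apply: ub_le_sup; last by exists u.
have N0 : 0 <= N by exact: op_normA_ge0.
(* A crude bound, used only to know that the set of values is bounded: its square
   [N ^+ 2 + 2 N ^+ 3 + N ^+ 4] dominates the two terms separately. *)
exists (N + N ^+ 2) => _ [v /= v1 <-]; apply: dw_shift_le => //.
  by rewrite addr_ge0 ?exprn_ge0.
move=> t /andP[t0 t1].
have : N ^+ 2 * (t * (1 - t)) <= N ^+ 2 * 1 by apply: ler_wpM2l; nra.
have : N ^+ 4 * t ^+ 2 <= N ^+ 4 * 1 by apply: ler_wpM2l; [exact: exprn_ge0|nra].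
have : 0 <= N * N ^+ 2 by rewrite mulr_ge0 ?exprn_ge0.
lra.
Qed.

(** The bound concerns one unit vector [x] instead of [N], because the supremum [N] need not be
    attained. *)
Lemma dwA_shift_ge (x : H) (t : R) : normA A x = 1 -> 0 <= t <= 1 ->
  normA A (X x) ^+ 2 * t * (1 - t) + normA A (X x) ^+ 4 * t ^+ 2 <=
  dwA AA SS ^+ 2.
Proof.
move=> x1 /andP[t0 t1]; set m := normA A (X x).
have [m0|m0] := eqVneq m 0.
  by rewrite m0 !expr0n !mul0r addr0 sqr_ge0.
have m_gt0 : 0 < m by rewrite lt_def m0 normA_ge0.
(* The scalars give the components of [u] squared seminorms [1 - t] and [t]. *)
pose s := Num.sqrt (1 - t) / m; pose r := Num.sqrt t.
have s0 : 0 <= s by rewrite divr_ge0 ?sqrtr_ge0// ltW.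
have s2 : s ^+ 2 * m ^+ 2 = 1 - t.
  by rewrite -exprMn divfK// sqr_sqrtr// subr_ge0.
have r2 : r ^+ 2 = t by rewrite sqr_sqrtr.
pose u : hsum H H := (s%:C%C *: X x, r%:C%C *: x).
have u1 : normA AA u = 1.
  apply/eqP; rewrite -(@eqrXn2 _ 2) ?normA_ge0// expr1n sqr_normA_block_diag/=.
  by rewrite !normAZ// x1 mulr1 exprMn !real_normK ?num_real// s2 r2 subrK.
rewrite -[X in _ <= X](sqr_sqrtr (sqr_ge0 _)) sqrtr_sqr ger0_norm ?dwA_shift_ge0//.
apply: le_trans (_ : _ <= dw_shift u ^+ 2) _; last first.
  by rewrite ler_sqr ?nnegrE ?dwA_shift_ge0 ?sqrtr_ge0// dw_shift_le_dwA.
rewrite /dw_shift innerA_shift normA_shift/= linearZ/= normAZ// -/m.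
rewrite innerAZl innerAZr innerA_selfE// -/m conjc_real -!rmorphM/=.
move: (m) (ltW m_gt0) s2 => n n0 s2.
rewrite expr0n/= addr0 !sqr_sqrtr ?addr_ge0 ?sqr_ge0 ?exprn_ge0 ?mulr_ge0//.
rewrite (ger0_norm (sqrtr_ge0 _)) -/r.
have -> : (r * (s * n ^+ 2)) ^+ 2 = r ^+ 2 * (s ^+ 2 * n ^+ 2) * n ^+ 2 by ring.
have -> : (r * n) ^+ 4 = (r ^+ 2) ^+ 2 * n ^+ 4 by ring.
by rewrite s2 r2; lra.
Qed.

End shift.

(** * Maximisation over [t] in the three cases *)

Theorem theorem2p35 (R : realType) (H : hilbertType R) (A X : {linear H -> H})
    (A_bnd : bounded_op A) (A_pos : positive_op A)
    (X_bnd : bounded_op X) (X_A_bnd : A_bounded A X) :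
  let O : {linear H -> H} := \0 in
  let AA := block_op A O O A in
  let SS := block_op O X O O in
  dwA AA SS =
    if op_normA A X == 0 then 0
    else if op_normA A X < 1 / Num.sqrt 2
    then op_normA A X / (2 * Num.sqrt (1 - op_normA A X ^+ 2))
    else op_normA A X ^+ 2.
Proof.
move=> O AA SS; set N := op_normA A X.
have N0 : 0 <= N by exact: op_normA_ge0.
have XN x : normA A x = 1 -> normA A (X x) <= N by exact: normA_le_op_normA.
have W0 : 0 <= dwA AA SS by exact: dwA_shift_ge0.
have N4 : N ^+ 4 = (N ^+ 2) ^+ 2 by rewrite -exprM.
have sqrt2_gt0 : 0 < Num.sqrt 2 :> R by rewrite sqrtr_gt0.
case: eqVneq => [Neq0|Nneq0].
  apply/eqP; rewrite eq_le W0 andbT; apply: dwA_shift_le => // t _.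
  by rewrite -/N Neq0 !expr0n !mul0r addr0.
have N_gt0 : 0 < N by rewrite lt_def Nneq0.
have sqrt2V : (1 / Num.sqrt 2) ^+ 2 = 1 / 2 :> R.
  by rewrite expr_div_n expr1n sqr_sqrtr.
case: ltP => [N_lt|N_ge].
  have N2_lt : N ^+ 2 < 1 / 2.
    by rewrite -sqrt2V ltr_sqr ?nnegrE// divr_ge0// ltW.
  set D := N / _.
  have d_gt0 : 0 < 1 - N ^+ 2 by lra.
  have D0 : 0 <= D by rewrite divr_ge0// mulr_ge0// sqrtr_ge0.
  have D2 : D ^+ 2 = N ^+ 2 / (4 * (1 - N ^+ 2)).
    rewrite expr_div_n exprMn sqr_sqrtr ?(ltW d_gt0)//; congr (_ / (_ * _)).
    by rewrite -natrX.
  apply/eqP; rewrite eq_le; apply/andP; split.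
    apply: dwA_shift_le => // t _; rewrite -/N D2 ler_pdivlMr ?mulr_gt0// N4.
    rewrite -subr_ge0; move: (N ^+ 2) (sqr_ge0 N) => M M0.
    (* The difference to be shown nonnegative is exactly [M * (1 - 2 * (1 - M) * t) ^+ 2], which
       vanishes at the optimal [t]. *)
    have := mulr_ge0 M0 (sqr_ge0 (1 - 2 * (1 - M) * t)); lra.
  rewrite -ler_sqr ?nnegrE// D2 ler_pdivrMr ?mulr_gt0//.
  set W := dwA AA SS ^+ 2; have W2 : 0 <= W by exact: sqr_ge0.
  (* With [t] optimal for [|X x|_A] instead of [N], the lower bound can be solved
     for [|X x|_A], so that no limit [|X x|_A --> N] is needed. *)
  suff : N ^+ 2 <= 4 * W / (1 + 4 * W) by rewrite ler_pdivlMr; lra.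
  set c := 4 * W / (1 + 4 * W).
  have c0 : 0 <= c by rewrite divr_ge0//; lra.
  rewrite -[c]sqr_sqrtr// ler_sqr ?nnegrE ?sqrtr_ge0//.
  apply: op_normA_le => [|x x1]; first exact: sqrtr_ge0.
  rewrite -ler_sqr ?nnegrE ?sqrtr_ge0// [leRHS]sqr_sqrtr// /c ler_pdivlMr; last by lra.
  (* This places the optimal [t = 1 / (2 * (1 - p))], with [p = normA A (X x) ^+ 2], in [[0, 1]]. *)
  have m2_lt : normA A (X x) ^+ 2 < 1 / 2.
    by apply: le_lt_trans N2_lt; rewrite ler_sqr ?nnegrE ?normA_ge0// XN.
  have := @dwA_shift_ge _ _ _ _ A_pos X_A_bnd x
    (1 / (2 * (1 - normA A (X x) ^+ 2))) x1.
  have -> : normA A (X x) ^+ 4 = (normA A (X x) ^+ 2) ^+ 2 by rewrite -exprM.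
  rewrite -/AA -/SS -/W; move: (normA A (X x) ^+ 2) m2_lt => p p_lt.
  have p1 : 0 < 1 - p by lra.
  have -> : p * (1 / (2 * (1 - p))) * (1 - 1 / (2 * (1 - p))) +
    p ^+ 2 * (1 / (2 * (1 - p))) ^+ 2 = p / (4 * (1 - p)).
    by field; rewrite gt_eqF.
  rewrite divr_ge0 ?mulr_ge0 ?(ltW p1)//= ler_pdivrMr ?mulr_gt0//.
  rewrite ler_pdivrMr ?mulr_gt0// => /(_ ltac:(lra)); lra.
have N2_ge : 1 / 2 <= N ^+ 2.
  by rewrite -sqrt2V ler_sqr ?nnegrE// divr_ge0// ltW.
apply/eqP; rewrite eq_le; apply/andP; split.
  apply: dwA_shift_le => //; first exact: sqr_ge0.
  move=> t /andP[t0 t1].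
  rewrite -/N N4; move: (N ^+ 2) N2_ge => M M_ge.
  rewrite -subr_ge0.
  have -> : M ^+ 2 - (M * t * (1 - t) + M ^+ 2 * t ^+ 2) =
    M * ((1 - t) * (M * (1 + t) - t)) by ring.
  (* The last factor is nonnegative since [M * (1 + t) >= (1 + t) / 2 >= t]. *)
  by rewrite mulr_ge0 ?mulr_ge0//; nra.
rewrite -[dwA _ _]sqr_sqrtr// ler_sqr ?nnegrE ?sqrtr_ge0//.
apply: op_normA_le => [|x x1]; first exact: sqrtr_ge0.
rewrite -ler_sqr ?nnegrE ?normA_ge0 ?sqrtr_ge0// [leRHS]sqr_sqrtr//.
rewrite -ler_sqr ?nnegrE ?sqr_ge0// -exprM.
(* At [t = 1] the lower bound reads [normA A (X x) ^+ 4 <= dwA AA SS ^+ 2]. *)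
have := @dwA_shift_ge _ _ _ _ A_pos X_A_bnd x 1 x1.
by rewrite ler01 lexx subrr mulr0 add0r expr1n mulr1; apply.
Qed.
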